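(* Let $\Omega\subseteq\mathbb C$ be open with $z\in\Omega\Leftrightarrow\bar z\in\Omega$, and let $f:\Omega\to\mathbb C$ be a continuously differentiable (in the real sense) valid function, i.e. $f(\bar z)=\overline{f(z)}$ for all $z\in\Omega$. Given quaternions $A$ and $B$, decompose $A=a_0+\bm a_1$ and $B=b_0+\bm b_1+\bm b_2$, where $a_0,b_0$ are real, $\bm a_1,\bm b_1,\bm b_2$ are 3-vectors (pure quaternions), $\bm b_1$ is parallel to $\bm a_1$, and $\bm b_2$ is perpendicular to $\bm a_1$. For every dual quaternion $A+\epsilon B$ with $a_0+i|\bm a_1|\in\Omega$, set $$f(A+\epsilon B)=g(A)+\epsilon f_x(A)b_0+h(A)(\bm a_1+\epsilon\bm b_2)+\epsilon f_{iy}(A)\bm b_1 = f(A)+\epsilon f_x(A)b_0+\epsilon f_{iy}(A)\bm b_1+\epsilon h(A)\bm b_2 .$$ Then the two expressions agree, and this formula extends the continuously differentiable valid functions on $\Omega$ to the set of dual quaternions $A+\epsilon B$ with $a_0+i|\bm a_1|\in\Omega$, in the sense of the functional calculus defined in the context. Moreover, for each such $f$, the map $\eta\mapsto f(\eta)$ is continuous on this set.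
   Context: A quaternion is $A=w+x\bm i+y\bm j+z\bm k$ with $\bm i^2=\bm j^2=\bm k^2=\bm i\bm j\bm k=-1$; its conjugate is $\bar A=w-x\bm i-y\bm j-z\bm k$, its norm is $|A|=(w^2+x^2+y^2+z^2)^{1/2}$, and it is pure if $w=0$. Vectors in $\mathbb R^3$ (3-vectors) are identified with pure quaternions via the standard basis $\bm i,\bm j,\bm k$. A dual quaternion is $\eta=A+\epsilon B$ with $A,B$ quaternions, where $\epsilon$ commutes with quaternions and $\epsilon^2=0$; its conjugate is $\bar\eta=\bar A+\epsilon\bar B$. The symbol $i$ is the complex imaginary unit and is not identified with $\bm i$. For continuously differentiable $f$: $f_x(x+iy)=\frac{\partial}{\partial x}f(x+iy)$ and $f_{iy}(x+iy)=-i\frac{\partial}{\partial y}f(x+iy)$; these are valid functions when $f$ is. Further, $g(x+iy)=\frac{f(x+iy)+f(x-iy)}2$, and $h(x+iy)=\frac{f(x+iy)-f(x-iy)}{2iy}$ if $y\ne0$, $h(x)=f_{iy}(x)$ if $y=0$; these are real valued, continuous and even in $y$, and $f(x+iy)=g(x+iy)+iy\,h(x+iy)$. Any valid function $F:\Omega\to\mathbb C$ is evaluated at a quaternion $A=a_0+\bm a_1$ with $a_0+i|\bm a_1|\in\Omega$ by $F(A)=\operatorname{Re}F(a_0+i|\bm a_1|)+\operatorname{Im}F(a_0+i|\bm a_1|)\,\frac{\bm a_1}{|\bm a_1|}$ if $\bm a_1\neq0$, and $F(A)=F(a_0)$ (a real number) if $\bm a_1=0$. In particular $g(A)=g(a_0+i|\bm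 a_1|)$ and $h(A)=h(a_0+i|\bm a_1|)$ are real, and $f(A)=g(A)+h(A)\bm a_1$. Functional calculus: a class of functions extends to a set of dual quaternions if (1) the class contains $f(z)=1$ and $f(z)=z$, and is closed under $f+g$, $fg$, $\bar f$ and $af$ for real $a$; and (2) for each $\eta$ in the set, the map $f\mapsto f(\eta)$ sends the function $1$ to $1$, the function $z$ to $\eta$, $f+g$ to $f(\eta)+g(\eta)$, $fg$ to $f(\eta)g(\eta)$, $\bar f$ to $\overline{f(\eta)}$, and $af$ to $af(\eta)$ for real $a$. *)

(* Defs.v *)
(* Functions on a subset [Omega] of [C] are represented by total functions
   [C -> C]; only values on [Omega] matter. *)
From Stdlib Require Import Reals.
From Coquelicot Require Export Coquelicot.
Open Scope R_scope.

(* [(w, x, y, z)] is w + x i + y j + z k.  Being nested pairs, quaternions and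
   dual quaternions get Coquelicot's product topology, that of R^4 and R^8. *)
Definition quat : Type := (R * R * R * R)%type.

Definition mkquat (w x y z : R) : quat := (w, x, y, z).
Definition qw (A : quat) : R := fst (fst (fst A)).
Definition qx (A : quat) : R := snd (fst (fst A)).
Definition qy (A : quat) : R := snd (fst A).
Definition qz (A : quat) : R := snd A.

Definition quat_of_R (a : R) : quat := mkquat a 0 0 0.
Coercion quat_of_R : R >-> quat.

Definition qadd (A B : quat) : quat :=
  mkquat (qw A + qw B) (qx A + qx B) (qy A + qy B) (qz A + qz B).
Definition qopp (A : quat) : quat :=
  mkquat (- qw A) (- qx A) (- qy A) (- qz A).
Definition qmul (A B : quat) : quat :=
  mkquat (qw A * qw B - qx A * qx B - qy A * qy B - qz A * qz B)
         (qw A * qx B + qx A * qw B + qy A * qz B - qz A * qy B)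
         (qw A * qy B - qx A * qz B + qy A * qw B + qz A * qx B)
         (qw A * qz B + qx A * qy B - qy A * qx B + qz A * qw B).
Definition qconj (A : quat) : quat := mkquat (qw A) (- qx A) (- qy A) (- qz A).
Definition qnorm (A : quat) : R :=
  sqrt (qw A ^ 2 + qx A ^ 2 + qy A ^ 2 + qz A ^ 2).

Declare Scope quat_scope.
Delimit Scope quat_scope with quat.
Bind Scope quat_scope with quat.
Notation "A + B" := (qadd A B) : quat_scope.
Notation "A - B" := (qadd A (qopp B)) : quat_scope.
Notation "A * B" := (qmul A B) : quat_scope.

Definition pure (A : quat) : Prop := qw A = 0.
Definition qvec (A : quat) : quat := mkquat 0 (qx A) (qy A) (qz A).

(* The next three notions are meant for pure quaternions. *)
Definition dot (a b : quat) : R := qx a * qx b + qy a * qy b + qz a * qz b.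
Definition perpendicular (a b : quat) : Prop := dot a b = 0.
(* Linear dependence: every vector is parallel to 0. *)
Definition parallel (a b : quat) : Prop :=
  exists s t : R, (s <> 0 \/ t <> 0) /\ (s * a + t * b)%quat = 0.

(* [(A, B)] is A + epsilon B. *)
Definition dquat : Type := (quat * quat)%type.

Definition mkdquat (A B : quat) : dquat := (A, B).
Definition std_part (eta : dquat) : quat := fst eta.
Definition eps_part (eta : dquat) : quat := snd eta.

Definition dquat_of_quat (A : quat) : dquat := mkdquat A 0.
Coercion dquat_of_quat : quat >-> dquat.

Definition eps : dquat := mkdquat 0 1.
Definition dadd (eta th : dquat) : dquat :=
  mkdquat (std_part eta + std_part th)%quat (eps_part eta + eps_part th)%quat.
Definition dmul (eta th : dquat) : dquat :=
  mkdquat (std_part eta * std_part th)%quat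
          (std_part eta * eps_part th + eps_part eta * std_part th)%quat.
Definition dconj (eta : dquat) : dquat :=
  mkdquat (qconj (std_part eta)) (qconj (eps_part eta)).

Declare Scope dquat_scope.
Delimit Scope dquat_scope with dquat.
Bind Scope dquat_scope with dquat.
Notation "eta + th" := (dadd eta th) : dquat_scope.
Notation "eta * th" := (dmul eta th) : dquat_scope.

Definition valid (Omega : C -> Prop) (f : C -> C) : Prop :=
  forall z : C, Omega z -> f (Cconj z) = Cconj (f z).

Definition d_dx (f : C -> C) (z : C) : C :=
  (Derive (fun t : R => Re (f (t, Im z))) (Re z),
   Derive (fun t : R => Im (f (t, Im z))) (Re z)).
Definition d_dy (f : C -> C) (z : C) : C :=
  (Derive (fun t : R => Re (f (Re z, t))) (Im z),
   Derive (fun t : R => Im (f (Re z, t))) (Im z)).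

Definition f_x (f : C -> C) (z : C) : C := d_dx f z.
Definition f_iy (f : C -> C) (z : C) : C := (- Ci * d_dy f z)%C.

(* Real (Frechet) differentiability at each point of [Omega]; the derivative
   is continuous iff its matrix entries, the partial derivatives, are. *)
Definition continuously_differentiable (Omega : C -> Prop) (f : C -> C) : Prop :=
  (forall z : C, Omega z ->
     @ex_filterdiff R_AbsRing C_R_NormedModule C_R_NormedModule f (locally z)) /\
  continuous_on Omega (d_dx f) /\ continuous_on Omega (d_dy f).

Definition C1_valid (Omega : C -> Prop) (f : C -> C) : Prop :=
  continuously_differentiable Omega f /\ valid Omega f.

Definition g_part (f : C -> C) (z : C) : C := ((f z + f (Cconj z)) / 2)%C.
Definition h_part (f : C -> C) (z : C) : C :=
  if Req_EM_T (Im z) 0 then f_iy f z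
  else ((f z - f (Cconj z)) / (2 * Ci * Im z))%C.

(* On the real axis a valid function is real valued, so [Re] loses nothing. *)
Definition qeval (F : C -> C) (A : quat) : quat :=
  let a0 := qw A in
  let a1 := qvec A in
  let r := qnorm a1 in
  if Req_EM_T r 0 then Re (F (a0, 0))
  else (Re (F (a0, r)) + (Im (F (a0, r)) / r)%R * a1)%quat.

Definition deval_formula (f : C -> C) (a0 : R) (a1 : quat)
    (b0 : R) (b1 b2 : quat) : dquat :=
  let A : quat := (a0 + a1)%quat in
  (qeval (g_part f) A + eps * qeval (f_x f) A * b0
   + qeval (h_part f) A * (a1 + eps * b2) + eps * qeval (f_iy f) A * b1)%dquat.

Definition deval_formula' (f : C -> C) (a0 : R) (a1 : quat)
    (b0 : R) (b1 b2 : quat) : dquat :=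
  let A : quat := (a0 + a1)%quat in
  (qeval f A + eps * qeval (f_x f) A * b0
   + eps * qeval (f_iy f) A * b1 + eps * qeval (h_part f) A * b2)%dquat.

(* Orthogonal projection of [b] on the line of [a]; it is 0 when [a] is 0. *)
Definition proj_on (a b : quat) : quat := ((dot a b / dot a a)%R * a)%quat.

(* When the vector part of A is 0 the decomposition of B is not unique; this
   picks one of them. *)
Definition deval (f : C -> C) (eta : dquat) : dquat :=
  let A := std_part eta in
  let B := eps_part eta in
  let b1 := proj_on (qvec A) (qvec B) in
  deval_formula f (qw A) (qvec A) (qw B) b1 (qvec B - b1)%quat.

Definition dquat_domain (Omega : C -> Prop) (eta : dquat) : Prop :=
  Omega (qw (std_part eta), qnorm (qvec (std_part eta))).

(* [ev f eta] is f(eta).  The field [fc_ext] says that [ev] really acts on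
   functions on [Omega], not on their total representatives. *)
Record functional_calculus (Omega : C -> Prop) (cls : (C -> C) -> Prop)
    (D : dquat -> Prop) (ev : (C -> C) -> dquat -> dquat) : Prop := {
  fc_class_one : cls (fun _ => RtoC 1);
  fc_class_id : cls (fun z => z);
  fc_class_add : forall f g, cls f -> cls g -> cls (fun z => (f z + g z)%C);
  fc_class_mul : forall f g, cls f -> cls g -> cls (fun z => (f z * g z)%C);
  fc_class_conj : forall f, cls f -> cls (fun z => Cconj (f z));
  fc_class_scal : forall (a : R) f, cls f -> cls (fun z => (a * f z)%C);

  fc_ext : forall f g eta, D eta -> cls f -> cls g ->
    (forall z, Omega z -> f z = g z) -> ev f eta = ev g eta;
  fc_one : forall eta, D eta -> ev (fun _ => RtoC 1) eta = 1;
  fc_id : forall eta, D eta -> ev (fun z => z) eta = eta;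
  fc_add : forall f g eta, D eta -> cls f -> cls g ->
    ev (fun z => (f z + g z)%C) eta = (ev f eta + ev g eta)%dquat;
  fc_mul : forall f g eta, D eta -> cls f -> cls g ->
    ev (fun z => (f z * g z)%C) eta = (ev f eta * ev g eta)%dquat;
  fc_conj : forall f eta, D eta -> cls f ->
    ev (fun z => Cconj (f z)) eta = dconj (ev f eta);
  fc_scal : forall (a : R) f eta, D eta -> cls f ->
    ev (fun z => (a * f z)%C) eta = (a * ev f eta)%dquat
}.

(* Main.v *)
(* For [A] with vector part of length [r], put [n = a1 / r] (and [n = 0] when [r = 0]) and
   [f = u + i v] at the point [z = qw A + i r].  Everything follows from one closed form:
   [f(A + eps B)] has standard part [u + v n] and dual part
   [(u_x b0 + u_y t) + h b + (v_x b0 + (v_y - h) t) n], where [b] is the vector part of [B],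
   [t] is the dot product of [n] and [b], and [h = v / y], extended by [v_y] to [y = 0].
   The algebraic laws are then polynomial identities modulo [n n = -1] when [r <> 0], and
   use [v = 0] when [r = 0].  For continuity, [h] is continuous by the mean value theorem,
   while [n], bounded but discontinuous at [r = 0], occurs only multiplied by [v], [u_y],
   [v_x] or [v_y - h], all of which vanish on the real axis: by validity, [u] is even and
   [v] is odd in [y]. *)
Require Import Defs.
From Stdlib Require Import Reals Lra.
From Coquelicot Require Import Coquelicot.
Open Scope R_scope.

(** * Partial derivatives and real-valued functions of class C^1 on the plane *)

(** The slices are written as in [d_dx] and [d_dy], so that the components of these are partial
    derivatives by conversion. *)
Definition par_x (phi : C -> R) (z : C) : R := Derive (fun t : R => phi (t, Im z)) (Re z).
Definition par_y (phi : C -> R) (z : C) : R := Derive (fun t : R => phi (Re z, t)) (Im z).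

Definition differentiable_at (phi : C -> R) (z : C) : Prop :=
  @ex_filterdiff R_AbsRing C_R_NormedModule R_NormedModule phi (locally z).

(** Continuity is asked at points of the plane, not relative to [Omega]; for open [Omega] the two
    agree, and this form composes directly. *)
Definition C1_on (Omega : C -> Prop) (phi : C -> R) : Prop :=
  forall z : C, Omega z ->
    differentiable_at phi z /\ continuous (par_x phi) z /\ continuous (par_y phi) z.

(** * Continuity of pairs, sums and products *)

(** Uncurried, [pair] is the identity of the product up to surjective pairing, so composition
    suffices. *)
Lemma continuous_pair {U V W : UniformSpace} (f : U -> V) (g : U -> W) (x : U) :
  continuous f x -> continuous g x -> continuous (fun t => (f t, g t)) x.
Proof.
  intros Hf Hg.
  apply (continuous_comp_2 f g pair x Hf Hg).
  apply continuous_ext with (f := fun p : V * W => p).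
  - now intros [a b].
  - apply continuous_id.
Qed.

Lemma continuous_Rplus {U : UniformSpace} (f g : U -> R) (x : U) :
  continuous f x -> continuous g x -> continuous (fun t => f t + g t) x.
Proof. exact (continuous_plus (V := R_NormedModule) f g x). Qed.

Lemma continuous_Rmult {U : UniformSpace} (f g : U -> R) (x : U) :
  continuous f x -> continuous g x -> continuous (fun t => f t * g t) x.
Proof. exact (continuous_mult (K := R_AbsRing) f g x). Qed.

Lemma continuous_Ropp {U : UniformSpace} (f : U -> R) (x : U) :
  continuous f x -> continuous (fun t => - f t) x.
Proof. exact (continuous_opp (V := R_NormedModule) f x). Qed.

Lemma continuous_Re (z : C) : continuous (fun w : C => Re w) z.
Proof. destruct z as [x y]. apply (continuous_fst x y). Qed.

Lemma continuous_Im (z : C) : continuous (fun w : C => Im w) z.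
Proof. destruct z as [x y]. apply (continuous_snd x y). Qed.

Lemma continuous_loc_ext {U V : UniformSpace} (f g : U -> V) (x : U) :
  locally x (fun t => f t = g t) -> continuous f x -> continuous g x.
Proof.
  intros H Hf. unfold continuous.
  rewrite <- (locally_singleton _ _ H).
  exact (filterlim_ext_loc f g H Hf).
Qed.

(** * Reduction of complex-valued functions to real and imaginary parts *)

Lemma differentiable_Re (f : C -> C) (z : C) :
  @ex_filterdiff R_AbsRing C_R_NormedModule C_R_NormedModule f (locally z) ->
  differentiable_at (fun w => Re (f w)) z.
Proof.
  intros H. unfold differentiable_at.
  apply (ex_filterdiff_comp' (V := C_R_NormedModule) f (fun w : C => Re w)); auto.
  apply ex_filterdiff_linear.
  exact (is_linear_fst (U := R_NormedModule) (V := R_NormedModule)).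
Qed.

Lemma differentiable_Im (f : C -> C) (z : C) :
  @ex_filterdiff R_AbsRing C_R_NormedModule C_R_NormedModule f (locally z) ->
  differentiable_at (fun w => Im (f w)) z.
Proof.
  intros H. unfold differentiable_at.
  apply (ex_filterdiff_comp' (V := C_R_NormedModule) f (fun w : C => Im w)); auto.
  apply ex_filterdiff_linear.
  exact (is_linear_snd (U := R_NormedModule) (V := R_NormedModule)).
Qed.

Lemma ex_filterdiff_pair {U V W : NormedModule R_AbsRing} (f : U -> V) (g : U -> W) (x : U) :
  ex_filterdiff f (locally x) -> ex_filterdiff g (locally x) ->
  @ex_filterdiff R_AbsRing U (prod_NormedModule R_AbsRing V W)
    (fun t => (f t, g t)) (locally x).
Proof.
  intros Hf Hg.
  apply (ex_filterdiff_comp'_2 (W := prod_NormedModule R_AbsRing V W) f g pair); auto.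
  apply (ex_filterdiff_ext (fun p : V * W => p)).
  - now intros [a b].
  - apply (ex_filterdiff_id (V := prod_NormedModule R_AbsRing V W)).
Qed.

(** [Re] and [Im] are linear, and a pair is differentiable when its components are. Openness turns
    [continuous_on] into continuity at each point. Afterwards only real-valued calculus rules are
    needed. *)
Lemma C1_components (Omega : C -> Prop) (hopen : open Omega) (f : C -> C) :
  continuously_differentiable Omega f <->
  C1_on Omega (fun z => Re (f z)) /\ C1_on Omega (fun z => Im (f z)).
Proof.
  split.
  - intros [Hd [Hx Hy]].
    assert (Cx : forall z, Omega z -> continuous (d_dx f) z)
      by (intros z Hz; exact (continuous_continuous_on _ _ _ (hopen z Hz) Hx)).
    assert (Cy : forall z, Omega z -> continuous (d_dy f) z)
      by (intros z Hz; exact (continuous_continuous_on _ _ _ (hopen z Hz) Hy)).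
    split; intros z Hz; (split; [|split]).
    + now apply differentiable_Re, Hd.
    + exact (continuous_comp (d_dx f) Re z (Cx z Hz) (continuous_Re _)).
    + exact (continuous_comp (d_dy f) Re z (Cy z Hz) (continuous_Re _)).
    + now apply differentiable_Im, Hd.
    + exact (continuous_comp (d_dx f) Im z (Cx z Hz) (continuous_Im _)).
    + exact (continuous_comp (d_dy f) Im z (Cy z Hz) (continuous_Im _)).
  - intros [Hu Hv]. split; [|split].
    + intros z Hz.
      apply (@ex_filterdiff_ext R_AbsRing C_R_NormedModule C_R_NormedModule (locally z) _
              (fun w => (Re (f w), Im (f w)))).
      * intros w. now destruct (f w).
      * apply (ex_filterdiff_pair (U := C_R_NormedModule) (V := R_NormedModule)
                 (W := R_NormedModule)); [apply Hu | apply Hv]; exact Hz.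
    + apply continuous_on_forall. intros z Hz.
      destruct (Hu z Hz) as [_ [? ?]], (Hv z Hz) as [_ [? ?]].
      now apply (@continuous_pair C_UniformSpace R_UniformSpace R_UniformSpace
        (par_x (fun w => Re (f w))) (par_x (fun w => Im (f w))) z).
    + apply continuous_on_forall. intros z Hz.
      destruct (Hu z Hz) as [_ [? ?]], (Hv z Hz) as [_ [? ?]].
      now apply (@continuous_pair C_UniformSpace R_UniformSpace R_UniformSpace
        (par_y (fun w => Re (f w))) (par_y (fun w => Im (f w))) z).
Qed.

(** * Slices and differentiation rules *)

Lemma differentiable_slice_x (phi : C -> R) (x y : R) :
  differentiable_at phi (x, y) -> ex_derive (fun t : R => phi (t, y)) x.
Proof.
  intros H. apply ex_derive_filterdiff.
  apply (ex_filterdiff_comp' (U := R_NormedModule) (V := C_R_NormedModule)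
           (fun t : R => (t, y)) phi); auto.
  apply (ex_filterdiff_pair (U := R_NormedModule) (V := R_NormedModule) (W := R_NormedModule)).
  - apply ex_filterdiff_id.
  - apply (ex_filterdiff_const (U := R_NormedModule) (V := R_NormedModule)).
Qed.

Lemma differentiable_slice_y (phi : C -> R) (x y : R) :
  differentiable_at phi (x, y) -> ex_derive (fun t : R => phi (x, t)) y.
Proof.
  intros H. apply ex_derive_filterdiff.
  apply (ex_filterdiff_comp' (U := R_NormedModule) (V := C_R_NormedModule)
           (fun t : R => (x, t)) phi); auto.
  apply (ex_filterdiff_pair (U := R_NormedModule) (V := R_NormedModule) (W := R_NormedModule)).
  - apply (ex_filterdiff_const (U := R_NormedModule) (V := R_NormedModule)).
  - apply ex_filterdiff_id.
Qed.

Lemma differentiable_continuous (phi : C -> R) (z : C) :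
  differentiable_at phi z -> continuous phi z.
Proof.
  exact (filterdiff_continuous (U := C_R_NormedModule) (V := R_NormedModule) phi z).
Qed.

Lemma par_x_plus (p q : C -> R) (z : C) : differentiable_at p z -> differentiable_at q z ->
  par_x (fun w => p w + q w) z = par_x p z + par_x q z.
Proof.
  destruct z as [x y]. intros Hp Hq. apply Derive_plus; now apply differentiable_slice_x.
Qed.

Lemma par_y_plus (p q : C -> R) (z : C) : differentiable_at p z -> differentiable_at q z ->
  par_y (fun w => p w + q w) z = par_y p z + par_y q z.
Proof.
  destruct z as [x y]. intros Hp Hq. apply Derive_plus; now apply differentiable_slice_y.
Qed.

Lemma par_x_mult (p q : C -> R) (z : C) : differentiable_at p z -> differentiable_at q z ->
  par_x (fun w => p w * q w) z = par_x p z * q z + p z * par_x q z.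
Proof.
  destruct z as [x y]. intros Hp Hq.
  apply (Derive_mult (fun t => p (t, y)) (fun t => q (t, y)));
    now apply differentiable_slice_x.
Qed.

Lemma par_y_mult (p q : C -> R) (z : C) : differentiable_at p z -> differentiable_at q z ->
  par_y (fun w => p w * q w) z = par_y p z * q z + p z * par_y q z.
Proof.
  destruct z as [x y]. intros Hp Hq.
  apply (Derive_mult (fun t => p (x, t)) (fun t => q (x, t)));
    now apply differentiable_slice_y.
Qed.

Lemma par_x_opp (p : C -> R) (z : C) : par_x (fun w => - p w) z = - par_x p z.
Proof. exact (Derive_opp _ _). Qed.

Lemma par_y_opp (p : C -> R) (z : C) : par_y (fun w => - p w) z = - par_y p z.
Proof. exact (Derive_opp _ _). Qed.

Lemma par_x_const (c : R) (z : C) : par_x (fun _ => c) z = 0.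
Proof. exact (Derive_const c _). Qed.

Lemma par_y_const (c : R) (z : C) : par_y (fun _ => c) z = 0.
Proof. exact (Derive_const c _). Qed.

Lemma differentiable_plus (p q : C -> R) (z : C) :
  differentiable_at p z -> differentiable_at q z ->
  differentiable_at (fun w => p w + q w) z.
Proof.
  exact (@ex_filterdiff_plus_fct R_AbsRing C_R_NormedModule R_NormedModule (locally z) _ p q).
Qed.

Lemma differentiable_mult (p q : C -> R) (z : C) :
  differentiable_at p z -> differentiable_at q z ->
  differentiable_at (fun w => p w * q w) z.
Proof.
  exact (@ex_filterdiff_mult_fct R_AbsRing C_R_NormedModule p q z Rmult_comm).
Qed.

Lemma differentiable_opp (p : C -> R) (z : C) :
  differentiable_at p z -> differentiable_at (fun w => - p w) z.
Proof.
  exact (@ex_filterdiff_opp_fct R_AbsRing C_R_NormedModule R_NormedModule (locally z) _ p).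
Qed.

(** * Closure properties of C^1 functions, and the coordinate functions *)

(** The sum rule holds at points of differentiability, so the partial derivatives are identified
    with continuous functions on a neighbourhood inside the open set [Omega]. *)
Lemma C1_plus (Omega : C -> Prop) (hopen : open Omega) (p q : C -> R) :
  C1_on Omega p -> C1_on Omega q -> C1_on Omega (fun w => p w + q w).
Proof.
  intros Hp Hq z Hz.
  destruct (Hp z Hz) as [dp [px py]], (Hq z Hz) as [dq [qx' qy']].
  split; [now apply differentiable_plus|split].
  - apply continuous_loc_ext with (fun w => par_x p w + par_x q w).
    + generalize (hopen z Hz). apply filter_imp. intros w Hw. symmetry.
      apply par_x_plus; [apply Hp | apply Hq]; exact Hw.
    + now apply continuous_Rplus.
  - apply continuous_loc_ext with (fun w => par_y p w + par_y q w).
    + generalize (hopen z Hz). apply filter_imp. intros w Hw. symmetry.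
      apply par_y_plus; [apply Hp | apply Hq]; exact Hw.
    + now apply continuous_Rplus.
Qed.

Lemma C1_opp (Omega : C -> Prop) (p : C -> R) :
  C1_on Omega p -> C1_on Omega (fun w => - p w).
Proof.
  intros Hp z Hz. destruct (Hp z Hz) as [dp [px py]].
  split; [now apply differentiable_opp|split].
  - apply continuous_ext with (fun w => - par_x p w); [|now apply continuous_Ropp].
    intros w. symmetry. apply par_x_opp.
  - apply continuous_ext with (fun w => - par_y p w); [|now apply continuous_Ropp].
    intros w. symmetry. apply par_y_opp.
Qed.

Lemma C1_mult (Omega : C -> Prop) (hopen : open Omega) (p q : C -> R) :
  C1_on Omega p -> C1_on Omega q -> C1_on Omega (fun w => p w * q w).
Proof.
  intros Hp Hq z Hz.
  destruct (Hp z Hz) as [dp [px py]], (Hq z Hz) as [dq [qx' qy']].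
  pose proof (differentiable_continuous _ _ dp).
  pose proof (differentiable_continuous _ _ dq).
  split; [now apply differentiable_mult|split].
  - apply continuous_loc_ext with (fun w => par_x p w * q w + p w * par_x q w).
    + generalize (hopen z Hz). apply filter_imp. intros w Hw. symmetry.
      apply par_x_mult; [apply Hp | apply Hq]; exact Hw.
    + apply continuous_Rplus; now apply continuous_Rmult.
  - apply continuous_loc_ext with (fun w => par_y p w * q w + p w * par_y q w).
    + generalize (hopen z Hz). apply filter_imp. intros w Hw. symmetry.
      apply par_y_mult; [apply Hp | apply Hq]; exact Hw.
    + apply continuous_Rplus; now apply continuous_Rmult.
Qed.

Lemma C1_const (Omega : C -> Prop) (c : R) : C1_on Omega (fun _ => c).
Proof.
  intros z _. split; [|split].
  - exact (@ex_filterdiff_const R_AbsRing C_R_NormedModule R_NormedModule (locally z) _ c).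
  - apply continuous_ext with (fun _ => 0); [|apply continuous_const].
    intros w. symmetry. apply par_x_const.
  - apply continuous_ext with (fun _ => 0); [|apply continuous_const].
    intros w. symmetry. apply par_y_const.
Qed.

Lemma par_x_Re (z : C) : par_x (fun w => Re w) z = 1.
Proof. exact (Derive_id _). Qed.

Lemma par_y_Re (z : C) : par_y (fun w => Re w) z = 0.
Proof. exact (Derive_const _ _). Qed.

Lemma par_x_Im (z : C) : par_x (fun w => Im w) z = 0.
Proof. exact (Derive_const _ _). Qed.

Lemma par_y_Im (z : C) : par_y (fun w => Im w) z = 1.
Proof. exact (Derive_id _). Qed.

Lemma C1_Re (Omega : C -> Prop) : C1_on Omega (fun w => Re w).
Proof.
  intros z _. split; [|split].
  - exact (differentiable_Re (fun w => w) z (@ex_filterdiff_id R_AbsRing C_R_NormedModule _)).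
  - apply continuous_ext with (fun _ => 1); [|apply continuous_const].
    intros w. symmetry. apply par_x_Re.
  - apply continuous_ext with (fun _ => 0); [|apply continuous_const].
    intros w. symmetry. apply par_y_Re.
Qed.

Lemma C1_Im (Omega : C -> Prop) : C1_on Omega (fun w => Im w).
Proof.
  intros z _. split; [|split].
  - exact (differentiable_Im (fun w => w) z (@ex_filterdiff_id R_AbsRing C_R_NormedModule _)).
  - apply continuous_ext with (fun _ => 0); [|apply continuous_const].
    intros w. symmetry. apply par_x_Im.
  - apply continuous_ext with (fun _ => 1); [|apply continuous_const].
    intros w. symmetry. apply par_y_Im.
Qed.

(** * Consequences of validity on the real axis *)

Lemma valid_Re (Omega : C -> Prop) (f : C -> C) (z : C) :
  valid Omega f -> Omega z -> Re (f (Cconj z)) = Re (f z).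
Proof. intros Hf Hz. now rewrite (Hf z Hz). Qed.

Lemma valid_Im (Omega : C -> Prop) (f : C -> C) (z : C) :
  valid Omega f -> Omega z -> Im (f (Cconj z)) = - Im (f z).
Proof. intros Hf Hz. now rewrite (Hf z Hz). Qed.

(** A real point is its own conjugate, so the imaginary part there equals its opposite. *)
Lemma valid_real (Omega : C -> Prop) (f : C -> C) (x : R) :
  valid Omega f -> Omega (x, 0) -> Im (f (x, 0)) = 0.
Proof.
  intros Hf Hz. pose proof (valid_Im Omega f _ Hf Hz) as H.
  unfold Cconj in H. cbn [fst snd] in H. rewrite Ropp_0 in H. lra.
Qed.

(** By the chain rule [phi (- t)] has derivative [- Derive phi 0] at 0, and evenness makes this
    equal to [Derive phi 0]. *)
Lemma Derive_even (phi : R -> R) :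
  ex_derive phi 0 -> locally 0 (fun t : R => phi (- t) = phi t) -> Derive phi 0 = 0.
Proof.
  intros Hd He.
  assert (H : Derive (fun t => phi (- t)) 0 = - Derive phi 0).
  { apply is_derive_unique.
    replace (- Derive phi 0) with (scal (-1) (Derive phi 0))
      by (unfold scal; simpl; unfold mult; simpl; ring).
    apply (is_derive_comp phi (fun t => - t)).
    - rewrite Ropp_0. now apply Derive_correct.
    - auto_derive; [trivial|ring]. }
  rewrite (Derive_ext_loc _ phi 0 He) in H. lra.
Qed.

(** Balls of [C] are squares, so shrinking the imaginary part of a point keeps it inside a ball
    centred on the real axis. *)
Lemma ball_C (z w : C) (e : posreal) :
  ball z e w <-> Rabs (Re w - Re z) < e /\ Rabs (Im w - Im z) < e.
Proof. reflexivity. Qed.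

(** Validity makes the vertical slice of the real part even near 0; openness supplies the
    neighbourhood. *)
Lemma par_y_Re_real (Omega : C -> Prop) (hopen : open Omega) (f : C -> C) (x : R) :
  C1_on Omega (fun z => Re (f z)) -> valid Omega f -> Omega (x, 0) ->
  par_y (fun z => Re (f z)) (x, 0) = 0.
Proof.
  intros Hc Hf Hz. apply (Derive_even (fun t : R => Re (f (x, t)))).
  - apply (differentiable_slice_y (fun z => Re (f z))). now apply Hc.
  - destruct (hopen _ Hz) as [d Hd]. exists d. intros t Ht.
    apply (valid_Re Omega f (x, t) Hf). apply Hd. split; [apply ball_center | exact Ht].
Qed.

Lemma par_x_Im_real (Omega : C -> Prop) (hopen : open Omega) (f : C -> C) (x : R) :
  valid Omega f -> Omega (x, 0) -> par_x (fun z => Im (f z)) (x, 0) = 0.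
Proof.
  intros Hf Hz. unfold par_x. cbn [Re Im fst snd].
  rewrite (Derive_ext_loc _ (fun _ => 0)).
  - apply Derive_const.
  - destruct (hopen _ Hz) as [d Hd]. exists d. intros t Ht.
    apply (valid_real Omega f t Hf). apply Hd. split; [exact Ht | apply ball_center].
Qed.

(** * The quotient [v / y] and its extension to the real axis *)

(** For valid [f] with imaginary part [v] this is the function [h]. It is defined for any
    real-valued [v], so that sums and opposites can be treated term by term. *)
Definition slope (v : C -> R) (z : C) : R :=
  if Req_EM_T (Im z) 0 then par_y v z else v z / Im z.

Lemma slope_real (v : C -> R) (x : R) : slope v (x, 0) = par_y v (x, 0).
Proof. unfold slope. cbn [Im snd]. now destruct (Req_EM_T 0 0). Qed.

(** The mean value theorem on the segment from [(x, 0)] to [(x, y)] removes the case distinction of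
    [slope]; for [y = 0] the witness is 0. *)
Lemma slope_MVT (v : C -> R) (x y : R) :
  (forall t, Rabs t <= Rabs y -> differentiable_at v (x, t)) -> v (x, 0) = 0 ->
  exists c, Rabs c <= Rabs y /\ slope v (x, y) = par_y v (x, c).
Proof.
  intros Hd H0. unfold slope. cbn [Im snd].
  destruct (Req_EM_T y 0) as [->|Hy]; [exists 0; split; [lra | reflexivity]|].
  assert (Hb : forall c, Rmin 0 y <= c <= Rmax 0 y -> Rabs c <= Rabs y).
  { intros c. unfold Rmin, Rmax, Rabs.
    destruct (Rle_dec 0 y), (Rcase_abs c), (Rcase_abs y); lra. }
  destruct (MVT_gen (fun t => v (x, t)) 0 y (fun t => par_y v (x, t))) as [c [Hc He]].
  - intros t Ht. apply Derive_correct. apply differentiable_slice_y.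
    apply Hd, Hb. lra.
  - intros t Ht. apply continuity_pt_filterlim.
    apply (ex_derive_continuous (V := R_NormedModule) (fun t => v (x, t))).
    apply differentiable_slice_y. now apply Hd, Hb.
  - exists c. split; [now apply Hb|].
    rewrite H0 in He. rewrite !Rminus_0_r in He. rewrite He. now field.
Qed.

(** Near a real point, slopes are values of [par_y v] at nearby points, so continuity of [par_y v]
    suffices; elsewhere [slope] is locally a continuous quotient. *)
Lemma slope_continuous (Omega : C -> Prop) (hopen : open Omega) (v : C -> R) (z : C) :
  C1_on Omega v -> (forall x, Omega (x, 0) -> v (x, 0) = 0) -> Omega z ->
  continuous (slope v) z.
Proof.
  intros Hv H0 Hz. destruct z as [x y].
  destruct (Req_dec y 0) as [->|Hy].
  - destruct (Hv _ Hz) as [_ [_ Hc]].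
    apply filterlim_locally. intros e.
    destruct (hopen _ Hz) as [d1 Hd1].
    pose proof (proj1 (filterlim_locally _ _) Hc e) as [d2 Hd2].
    (* [d1] keeps the vertical segment of the mean value theorem inside [Omega]; [d2] controls the
       variation of [par_y v]. *)
    assert (Hd : 0 < Rmin d1 d2) by (apply Rmin_pos; apply cond_pos).
    exists (mkposreal _ Hd). intros [x' y'] Hb.
    apply (proj1 (ball_C (x, 0) (x', y') _)) in Hb.
    cbn [Re Im fst snd pos] in Hb. rewrite Rminus_0_r in Hb. destruct Hb as [Hx' Hy'].
    pose proof (Rmin_l d1 d2). pose proof (Rmin_r d1 d2). pose proof (Rabs_pos y').
    assert (Hin : forall t, Rabs t <= Rabs y' -> Omega (x', t)).
    { intros t Ht. apply Hd1. apply (proj2 (ball_C (x, 0) (x', t) d1)).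
      cbn [Re Im fst snd]. rewrite Rminus_0_r. lra. }
    destruct (slope_MVT v x' y') as [c [Hcy ->]].
    + intros t Ht. now apply Hv, Hin.
    + apply H0, Hin. rewrite Rabs_R0. lra.
    + rewrite slope_real. apply Hd2. apply (proj2 (ball_C (x, 0) (x', c) d2)).
      cbn [Re Im fst snd]. rewrite Rminus_0_r. lra.
  - apply continuous_loc_ext with (fun w : C => v w * / Im w).
    (* The radius [Rabs y] excludes the real axis, where [slope] is not the quotient. *)
    + assert (Hp : 0 < Rabs y) by now apply Rabs_pos_lt.
      exists (mkposreal _ Hp). intros [x' y'] Hb.
      apply (proj1 (ball_C (x, y) (x', y') _)) in Hb.
      cbn [Re Im fst snd pos] in Hb. unfold slope. cbn [Im snd].
      destruct (Req_EM_T y' 0) as [->|]; [|reflexivity].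
      rewrite Rminus_0_l, Rabs_Ropp in Hb. lra.
    + apply continuous_Rmult; [now apply differentiable_continuous, Hv|].
      apply (continuous_comp (fun w : C => Im w) Rinv); [apply continuous_Im|].
      now apply continuous_Rinv.
Qed.

(** * Polar form of a quaternion and evaluation of functions at it *)

(** The unit vector [n]. For zero vector part it is 0 whatever [/ 0] is, since the factor [qvec A]
    vanishes. *)
Definition dir (A : quat) : quat := ((/ qnorm (qvec A))%R * qvec A)%quat.

Definition zpt (A : quat) : C := (qw A, qnorm (qvec A)).

(** Leaves [qnorm], [dir] and the real operations folded, so that quaternion identities become
    coordinatewise real ones. *)
Ltac qsimpl := cbv [mkdquat mkquat std_part eps_part dquat_of_quat quat_of_R
  qw qx qy qz qadd qopp qmul qconj dadd dmul dconj eps qvec dot fst snd].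
Ltac quat_eq := apply f_equal2; [apply f_equal2; [apply f_equal2|]|].
Ltac dquat_eq := apply f_equal2; quat_eq.

Lemma qnorm_sqr (A : quat) : qnorm (qvec A) * qnorm (qvec A) = dot (qvec A) (qvec A).
Proof.
  destruct A as [[[w x] y] z]. unfold qnorm. rewrite sqrt_sqrt; qsimpl; [ring|].
  pose proof (pow2_ge_0 x). pose proof (pow2_ge_0 y). pose proof (pow2_ge_0 z). lra.
Qed.

Lemma qnorm_eq0 (A : quat) : qnorm (qvec A) = 0 -> qvec A = 0.
Proof.
  intros H. pose proof (qnorm_sqr A) as H1. rewrite H in H1.
  destruct A as [[[w x] y] z]. revert H1. qsimpl. intros H1.
  pose proof (Rle_0_sqr x). pose proof (Rle_0_sqr y). pose proof (Rle_0_sqr z).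
  unfold Rsqr in *.
  rewrite (Rsqr_0_uniq x), (Rsqr_0_uniq y), (Rsqr_0_uniq z) by (unfold Rsqr; lra).
  reflexivity.
Qed.

Lemma dir_dot (A : quat) : qnorm (qvec A) <> 0 -> dot (dir A) (dir A) = 1.
Proof.
  intros H. apply Rmult_eq_reg_r with (qnorm (qvec A) * qnorm (qvec A)).
  - rewrite Rmult_1_l. rewrite qnorm_sqr at 2. unfold dir. qsimpl. field. exact H.
  - now apply Rmult_integral_contrapositive.
Qed.

Lemma dir_0 (A : quat) : qnorm (qvec A) = 0 -> dir A = 0.
Proof. intros H. unfold dir. rewrite (qnorm_eq0 A H). qsimpl. quat_eq; ring. Qed.

Lemma qvec_dir (A : quat) : qvec A = (qnorm (qvec A) * dir A)%quat.
Proof.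
  destruct (Req_dec (qnorm (qvec A)) 0) as [H|H].
  - rewrite H, (qnorm_eq0 A H). qsimpl. quat_eq; ring.
  - unfold dir. qsimpl. quat_eq; field; exact H.
Qed.

Lemma dir_pure (A : quat) : qw (dir A) = 0.
Proof. unfold dir. qsimpl. ring. Qed.

(** The value 0 of [dir A] at zero vector part absorbs the case distinction of [qeval]. *)
Lemma qeval_dir (F : C -> C) (A : quat) :
  qeval F A = (Re (F (zpt A)) + Im (F (zpt A)) * dir A)%quat.
Proof.
  unfold qeval, zpt. destruct (Req_EM_T (qnorm (qvec A)) 0) as [H|H].
  - rewrite (dir_0 A H), H. qsimpl. quat_eq; ring.
  - unfold dir, Rdiv. qsimpl. quat_eq; ring.
Qed.

Lemma qeval_g (Omega : C -> Prop) (f : C -> C) (A : quat) :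
  valid Omega f -> Omega (zpt A) -> qeval (g_part f) A = Re (f (zpt A)).
Proof.
  intros Hf Hz. rewrite qeval_dir. unfold g_part. rewrite (Hf _ Hz).
  destruct (f (zpt A)) as [u v]. cbn. qsimpl. quat_eq; field.
Qed.

(** Off the axis [f z - f (Cconj z)] is [2 i v] by validity. On the axis [f_iy f] has real part
    [v_y], and its imaginary part is multiplied by [dir A = 0]. *)
Lemma qeval_h (Omega : C -> Prop) (f : C -> C) (A : quat) :
  valid Omega f -> Omega (zpt A) ->
  qeval (h_part f) A = slope (fun z => Im (f z)) (zpt A).
Proof.
  intros Hf Hz. rewrite qeval_dir. unfold h_part, slope. rewrite (Hf _ Hz).
  change (Im (zpt A)) with (qnorm (qvec A)).
  destruct (Req_EM_T (qnorm (qvec A)) 0) as [H|H].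
  - rewrite (dir_0 A H). unfold f_iy, d_dy, par_y. cbn. qsimpl. quat_eq; ring.
  - destruct (f (zpt A)) as [u v]. generalize dependent (qnorm (qvec A)). intros r Hr.
    cbn. qsimpl. quat_eq; field; lra.
Qed.

Lemma proj_on_dir (A b : quat) :
  proj_on (qvec A) b = (dot (dir A) b * dir A)%quat.
Proof.
  destruct (Req_dec (qnorm (qvec A)) 0) as [H|H].
  - unfold proj_on. rewrite (dir_0 A H), (qnorm_eq0 A H). qsimpl. quat_eq; ring.
  - unfold proj_on. rewrite <- qnorm_sqr. unfold dir.
    generalize dependent (qnorm (qvec A)). intros r Hr. qsimpl. quat_eq; field; exact Hr.
Qed.

Lemma qvec_add (A : quat) : (qw A + qvec A)%quat = A.
Proof. destruct A as [[[w x] y] z]. qsimpl. quat_eq; ring. Qed.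

(** * The closed form of the dual evaluation *)

Definition deval_std (f : C -> C) (A : quat) : quat :=
  (Re (f (zpt A)) + Im (f (zpt A)) * dir A)%quat.

Definition deval_eps (f : C -> C) (A B : quat) : quat :=
  let u := fun z => Re (f z) in
  let v := fun z => Im (f z) in
  let t := dot (dir A) (qvec B) in
  ((par_x u (zpt A) * qw B + par_y u (zpt A) * t)%R + slope v (zpt A) * qvec B
   + (par_x v (zpt A) * qw B + (par_y v (zpt A) - slope v (zpt A)) * t)%R * dir A)%quat.

(** Multiplying [v / r] by [a1 = r n] cancels [r]; at [r = 0] both sides are 0. *)
Lemma slope_qvec (f : C -> C) (A : quat) :
  (slope (fun z => Im (f z)) (zpt A) * qvec A)%quat = (Im (f (zpt A)) * dir A)%quat.
Proof.
  destruct (Req_dec (qnorm (qvec A)) 0) as [H|H].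
  - rewrite (dir_0 A H), (qnorm_eq0 A H). qsimpl. quat_eq; ring.
  - rewrite (qvec_dir A) at 1. unfold slope. change (Im (zpt A)) with (qnorm (qvec A)).
    destruct (Req_EM_T (qnorm (qvec A)) 0); [easy|].
    generalize dependent (qnorm (qvec A)). intros r Hr _.
    generalize (dir A) as n. intros n. qsimpl. quat_eq; field; exact Hr.
Qed.

Lemma f_x_eq (f : C -> C) (z : C) :
  f_x f z = (par_x (fun z => Re (f z)) z, par_x (fun z => Im (f z)) z).
Proof. reflexivity. Qed.

Lemma f_iy_eq (f : C -> C) (z : C) :
  f_iy f z = (par_y (fun z => Im (f z)) z, - par_y (fun z => Re (f z)) z).
Proof.
  unfold f_iy, d_dy. fold (par_y (fun z => Re (f z)) z). fold (par_y (fun z => Im (f z)) z).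
  unfold Ci, Cmult, Copp. cbn [fst snd]. apply f_equal2; ring.
Qed.

(** The parallel part of [b] is [t n] and contributes [(v_y - u_y n) t n = u_y t + v_y t n], because
    [n n = -1] when [r <> 0]; the remaining part contributes [h (b - t n)]. At [r = 0] both [t] and
    [n] vanish. *)
Lemma deval_explicit (Omega : C -> Prop) (f : C -> C) (A B : quat) :
  valid Omega f -> Omega (zpt A) ->
  deval f (mkdquat A B) = mkdquat (deval_std f A) (deval_eps f A B).
Proof.
  intros Hf Hz. unfold deval, deval_formula. cbv zeta.
  change (std_part (mkdquat A B)) with A. change (eps_part (mkdquat A B)) with B.
  rewrite qvec_add, (qeval_g Omega f A Hf Hz), (qeval_h Omega f A Hf Hz), !qeval_dir,
    f_x_eq, f_iy_eq, proj_on_dir.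
  unfold deval_std. rewrite <- (slope_qvec f A). unfold deval_eps. cbv zeta.
  (* Multiplied by [t], the relation [n . n = 1] also holds for zero vector part, so one polynomial
     identity covers both cases. *)
  assert (Hn : dot (dir A) (qvec B) * dot (dir A) (dir A) = dot (dir A) (qvec B)).
  { destruct (Req_dec (qnorm (qvec A)) 0) as [H|H].
    - rewrite (dir_0 A H). qsimpl. ring.
    - rewrite (dir_dot A H). ring. }
  generalize (dir_pure A). revert Hn.
  cbn [Re Im fst snd].
  set (H := slope _ _). set (ux := par_x _ _). set (vx := par_x (fun z => Im (f z)) _).
  set (uy := par_y (fun z => Re (f z)) _). set (vy := par_y _ _).
  clearbody H ux vx uy vy.
  generalize (Re (f (zpt A))). intros u.
  destruct (dir A) as [[[n0 n1] n2] n3].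
  set (t := dot _ (qvec B)). intros Hn. change (qw (n0, n1, n2, n3)) with n0. intros ->.
  revert Hn. clearbody t. destruct A as [[[a0 a1] a2] a3], B as [[[b0 b1] b2] b3].
  qsimpl. intros Hn.
  assert (Hn' : t * n3 * n3 = t - t * n1 * n1 - t * n2 * n2) by lra.
  dquat_eq; ring [Hn'].
Qed.

(** * Agreement of the two formulas and independence of the decomposition *)

Lemma qvec_of_pure (a0 : R) (a1 : quat) : pure a1 -> qvec (a0 + a1)%quat = a1.
Proof.
  destruct a1 as [[[w x] y] z]. unfold pure. qsimpl. intros ->. quat_eq; ring.
Qed.

Lemma qw_of_pure (a0 : R) (a1 : quat) : pure a1 -> qw (a0 + a1)%quat = a0.
Proof. unfold pure. qsimpl. intros ->. ring. Qed.

(** The content is [f(A) = g(A) + h(A) a1], which is [slope_qvec]; the rest is distributivity. *)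
Lemma deval_formula_agree (Omega : C -> Prop) (f : C -> C) (a0 : R) (a1 : quat)
    (b0 : R) (b1 b2 : quat) :
  valid Omega f -> pure a1 -> Omega (a0, qnorm a1) ->
  deval_formula f a0 a1 b0 b1 b2 = deval_formula' f a0 a1 b0 b1 b2.
Proof.
  intros Hf Ha Hz. unfold deval_formula, deval_formula'. cbv zeta.
  pose proof (qvec_of_pure a0 a1 Ha) as Hv. pose proof (qw_of_pure a0 a1 Ha) as Hw.
  set (A := (a0 + a1)%quat) in *. clearbody A.
  rewrite <- Hv, <- Hw in Hz. fold (zpt A) in Hz. rewrite <- Hv.
  rewrite (qeval_g Omega f A Hf Hz), (qeval_h Omega f A Hf Hz), (qeval_dir f A),
    <- slope_qvec.
  generalize (qeval (f_x f) A) (qeval (f_iy f) A) (slope (fun z => Im (f z)) (zpt A))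
    (Re (f (zpt A))).
  intros [[[p0 p1] p2] p3] [[[q0 q1] q2] q3] H u.
  destruct A as [[[w x] y] z], b1 as [[[? ?] ?] ?], b2 as [[[? ?] ?] ?].
  qsimpl. dquat_eq; ring.
Qed.

(** In [s b + t a = 0] the case [s = 0] would force [a = 0]; hence [c = - t / s]. *)
Lemma parallel_multiple (a b : quat) :
  a <> 0 -> parallel b a -> exists c : R, b = (c * a)%quat.
Proof.
  intros Ha [s [t [Hst H]]].
  destruct a as [[[a0 a1] a2] a3], b as [[[b0 b1] b2] b3].
  revert H. qsimpl. intros H. injection H as H0 H1 H2 H3.
  destruct (Req_dec s 0) as [->|Hs].
  - exfalso. apply Ha.
    assert (Ht : t <> 0) by (destruct Hst; [lra | assumption]).
    qsimpl. quat_eq; apply Rmult_eq_reg_l with t; trivial; lra.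
  - exists (- t / s). qsimpl.
    quat_eq; apply Rmult_eq_reg_l with s; trivial; field_simplify; trivial; lra.
Qed.

(** For [a1 = 0] the values [f_iy(A)] and [h(A)] coincide, so only the sum [b1 + b2] enters. For
    [a1 <> 0] the vector [b1] has to be the orthogonal projection chosen by [deval]. *)
Lemma deval_decomposition (Omega : C -> Prop) (f : C -> C) (a0 : R) (a1 : quat)
    (b0 : R) (b1 b2 : quat) :
  valid Omega f -> pure a1 -> pure b1 -> pure b2 ->
  parallel b1 a1 -> perpendicular b2 a1 -> Omega (a0, qnorm a1) ->
  deval f (mkdquat (a0 + a1) (b0 + b1 + b2)) = deval_formula f a0 a1 b0 b1 b2.
Proof.
  intros Hf Ha Hb1 Hb2 Hpar Hperp Hz.
  pose proof (qvec_of_pure a0 a1 Ha) as Hv. pose proof (qw_of_pure a0 a1 Ha) as Hw.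
  assert (Hbv : qvec (b0 + b1 + b2)%quat = (b1 + b2)%quat).
  { revert Hb1 Hb2. clear. unfold pure.
    destruct b1 as [[[? ?] ?] ?], b2 as [[[? ?] ?] ?]. qsimpl. intros -> ->.
    quat_eq; ring. }
  assert (Hbw : qw (b0 + b1 + b2)%quat = b0).
  { revert Hb1 Hb2. unfold pure. qsimpl. intros -> ->. ring. }
  destruct (Req_dec (qnorm a1) 0) as [H|H].
  - rewrite <- Hv in H.
    rewrite <- Hv, <- Hw in Hz. fold (zpt (a0 + a1)%quat) in Hz.
    rewrite (deval_explicit Omega f _ _ Hf Hz). unfold deval_std, deval_eps, deval_formula.
    cbv zeta.
    rewrite (qeval_g Omega f _ Hf Hz), (qeval_h Omega f _ Hf Hz), !qeval_dir, Hbv, Hbw,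
      f_x_eq, f_iy_eq, (dir_0 _ H).
    assert (Ha1 : a1 = 0) by (rewrite <- Hv; now apply qnorm_eq0).
    unfold slope. change (Im (zpt (a0 + a1)%quat)) with (qnorm (qvec (a0 + a1)%quat)).
    destruct (Req_EM_T _ 0); [|easy].
    revert Ha1. generalize (zpt (a0 + a1)%quat). intros z ->. cbn [Re Im fst snd].
    generalize (par_x (fun z => Re (f z)) z) (par_y (fun z => Re (f z)) z)
      (par_x (fun z => Im (f z)) z) (par_y (fun z => Im (f z)) z)
      (fst (f z)) (snd (f z)). intros ux uy vx vy u v.
    destruct b1 as [[[? ?] ?] ?], b2 as [[[? ?] ?] ?]. qsimpl. dquat_eq; ring.
  - assert (Ha0 : a1 <> 0).
    { intros E. apply H. rewrite E. unfold qnorm. qsimpl.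
      transitivity (sqrt 0); [f_equal; ring | exact sqrt_0]. }
    destruct (parallel_multiple a1 b1 Ha0 Hpar) as [c Hc].
    (* Perpendicularity removes [b2] from the dot product, which leaves [c] as the coefficient of
       the projection. *)
    assert (Hp : proj_on a1 (b1 + b2)%quat = b1).
    { assert (Hn : dot a1 a1 <> 0).
      { rewrite <- Hv, <- qnorm_sqr, Hv. now apply Rmult_integral_contrapositive. }
      unfold proj_on. replace (dot a1 (b1 + b2)%quat / dot a1 a1) with c; [easy|].
      replace (dot a1 (b1 + b2)%quat) with (c * dot a1 a1); [now field|].
      assert (Hd : dot a1 (b1 + b2)%quat = dot a1 b1 + dot b2 a1) by (qsimpl; ring).
      rewrite Hd, Hperp, Hc. revert Ha. unfold pure. qsimpl. intros ->. ring. }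
    unfold deval. cbn zeta. change (std_part (mkdquat ?A ?B)) with A.
    change (eps_part (mkdquat ?A ?B)) with B.
    rewrite Hv, Hw, Hbv, Hbw, Hp. f_equal.
    destruct b1 as [[[? ?] ?] ?], b2 as [[[? ?] ?] ?]. qsimpl. quat_eq; ring.
Qed.

(** * Closure properties of the class of functions *)

(** Stated for every real constant, so that scaling reduces to the product with a constant
    function. *)
Lemma C1_valid_const (Omega : C -> Prop) (hopen : open Omega) (c : R) :
  C1_valid Omega (fun _ => RtoC c).
Proof.
  split; [apply C1_components; trivial; split; apply C1_const|].
  intros z _. unfold Cconj, RtoC. cbn [fst snd]. now rewrite Ropp_0.
Qed.

Lemma C1_valid_id (Omega : C -> Prop) (hopen : open Omega) : C1_valid Omega (fun z => z).
Proof.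
  split; [apply C1_components; trivial; split; [apply C1_Re | apply C1_Im]|].
  now intros z _.
Qed.

Lemma C1_valid_add (Omega : C -> Prop) (hopen : open Omega) (f g : C -> C) :
  C1_valid Omega f -> C1_valid Omega g -> C1_valid Omega (fun z => (f z + g z)%C).
Proof.
  intros [Hf Vf] [Hg Vg]. apply (C1_components Omega hopen) in Hf as [Hf1 Hf2].
  apply (C1_components Omega hopen) in Hg as [Hg1 Hg2]. split.
  - apply C1_components; trivial. split.
    + exact (C1_plus Omega hopen _ _ Hf1 Hg1).
    + exact (C1_plus Omega hopen _ _ Hf2 Hg2).
  - intros z Hz. rewrite Vf, Vg by exact Hz. symmetry. apply Cplus_conj.
Qed.

Lemma C1_valid_mul (Omega : C -> Prop) (hopen : open Omega) (f g : C -> C) :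
  C1_valid Omega f -> C1_valid Omega g -> C1_valid Omega (fun z => (f z * g z)%C).
Proof.
  intros [Hf Vf] [Hg Vg]. apply (C1_components Omega hopen) in Hf as [Hf1 Hf2].
  apply (C1_components Omega hopen) in Hg as [Hg1 Hg2]. split.
  - apply C1_components; trivial. split.
    + exact (C1_plus Omega hopen _ _ (C1_mult Omega hopen _ _ Hf1 Hg1)
               (C1_opp Omega _ (C1_mult Omega hopen _ _ Hf2 Hg2))).
    + exact (C1_plus Omega hopen _ _ (C1_mult Omega hopen _ _ Hf1 Hg2)
               (C1_mult Omega hopen _ _ Hf2 Hg1)).
  - intros z Hz. rewrite Vf, Vg by exact Hz. symmetry. apply Cmult_conj.
Qed.

Lemma C1_valid_conj (Omega : C -> Prop) (hopen : open Omega) (f : C -> C) :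
  C1_valid Omega f -> C1_valid Omega (fun z => Cconj (f z)).
Proof.
  intros [Hf Vf]. apply (C1_components Omega hopen) in Hf as [Hf1 Hf2]. split.
  - apply C1_components; trivial. split; [exact Hf1|]. exact (C1_opp Omega _ Hf2).
  - intros z Hz. now rewrite Vf.
Qed.

(** * Extensionality, constants, identity, sums and conjugates *)

Lemma par_x_ext_loc (p q : C -> R) (z : C) :
  locally z (fun w => p w = q w) -> par_x p z = par_x q z.
Proof.
  destruct z as [x y]. intros [d Hd]. apply Derive_ext_loc. exists d. intros t Ht.
  apply Hd. split; [exact Ht | apply ball_center].
Qed.

Lemma par_y_ext_loc (p q : C -> R) (z : C) :
  locally z (fun w => p w = q w) -> par_y p z = par_y q z.
Proof.
  destruct z as [x y]. intros [d Hd]. apply Derive_ext_loc. exists d. intros t Ht.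
  apply Hd. split; [apply ball_center | exact Ht].
Qed.

(** The closed form depends on the value and the partial derivatives at [zpt A], and the functions
    agree near this point because [Omega] is open. *)
Lemma deval_ext (Omega : C -> Prop) (hopen : open Omega) (f g : C -> C) (eta : dquat) :
  dquat_domain Omega eta -> valid Omega f -> valid Omega g ->
  (forall z, Omega z -> f z = g z) -> deval f eta = deval g eta.
Proof.
  destruct eta as [A B]. intros Hz Hf Hg Hfg.
  change (Omega (zpt A)) in Hz. change (A, B) with (mkdquat A B).
  rewrite (deval_explicit Omega f A B Hf Hz), (deval_explicit Omega g A B Hg Hz).
  assert (HR : locally (zpt A) (fun w : C => Re (f w) = Re (g w))).
  { generalize (hopen _ Hz). apply filter_imp. intros w Hw. now rewrite Hfg. }
  assert (HI : locally (zpt A) (fun w : C => Im (f w) = Im (g w))).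
  { generalize (hopen _ Hz). apply filter_imp. intros w Hw. now rewrite Hfg. }
  unfold deval_std, deval_eps, slope. cbv zeta.
  rewrite (Hfg _ Hz),
    (par_x_ext_loc (fun z => Re (f z)) (fun z => Re (g z)) _ HR),
    (par_x_ext_loc (fun z => Im (f z)) (fun z => Im (g z)) _ HI),
    (par_y_ext_loc (fun z => Re (f z)) (fun z => Re (g z)) _ HR),
    (par_y_ext_loc (fun z => Im (f z)) (fun z => Im (g z)) _ HI).
  reflexivity.
Qed.

Lemma slope_plus (p q : C -> R) (z : C) : differentiable_at p z -> differentiable_at q z ->
  slope (fun w => p w + q w) z = slope p z + slope q z.
Proof.
  intros Hp Hq. unfold slope. destruct (Req_EM_T (Im z) 0).
  - now apply par_y_plus.
  - unfold Rdiv. ring.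
Qed.

Lemma slope_opp (p : C -> R) (z : C) : slope (fun w => - p w) z = - slope p z.
Proof.
  unfold slope. destruct (Req_EM_T (Im z) 0).
  - apply par_y_opp.
  - unfold Rdiv. ring.
Qed.

Lemma slope_const0 (z : C) : slope (fun _ => 0) z = 0.
Proof.
  unfold slope. destruct (Req_EM_T (Im z) 0).
  - apply par_y_const.
  - unfold Rdiv. ring.
Qed.

Lemma slope_Im (z : C) : slope (fun w => Im w) z = 1.
Proof.
  unfold slope. destruct (Req_EM_T (Im z) 0).
  - apply par_y_Im.
  - now field.
Qed.

Lemma deval_const (Omega : C -> Prop) (c : R) (eta : dquat) :
  dquat_domain Omega eta -> deval (fun _ => RtoC c) eta = c.
Proof.
  destruct eta as [A B]. intros Hz. change (A, B) with (mkdquat A B).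
  rewrite (deval_explicit Omega) by
    (try exact Hz; intros z _; unfold Cconj, RtoC; cbn [fst snd]; now rewrite Ropp_0).
  unfold deval_std, deval_eps. cbv zeta. unfold RtoC. cbn [Re Im fst snd].
  rewrite !par_x_const, !par_y_const, slope_const0.
  generalize (dir A). intros [[[? ?] ?] ?]. destruct B as [[[? ?] ?] ?]. qsimpl.
  dquat_eq; ring.
Qed.

(** Here [u_x = v_y = h = 1] and [u_y = v_x = 0], so the coefficient of [n] in the dual part
    vanishes and [b0 + b] remains. *)
Lemma deval_id (Omega : C -> Prop) (eta : dquat) :
  dquat_domain Omega eta -> deval (fun z => z) eta = eta.
Proof.
  destruct eta as [A B]. intros Hz. change (A, B) with (mkdquat A B).
  rewrite (deval_explicit Omega) by (try exact Hz; easy).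
  unfold deval_std, deval_eps. cbv zeta.
  rewrite par_x_Re, par_y_Re, par_x_Im, par_y_Im, slope_Im.
  change (Im (zpt A)) with (qnorm (qvec A)). rewrite <- qvec_dir.
  change (Re (zpt A)) with (qw A). rewrite qvec_add.
  destruct A as [[[? ?] ?] ?], B as [[[? ?] ?] ?].
  generalize (dir (r, r0, r1, r2)). intros [[[? ?] ?] ?]. qsimpl.
  dquat_eq; ring.
Qed.

Lemma C1_valid_spec (Omega : C -> Prop) (hopen : open Omega) (f : C -> C) :
  C1_valid Omega f ->
  C1_on Omega (fun z => Re (f z)) /\ C1_on Omega (fun z => Im (f z)) /\ valid Omega f.
Proof.
  intros [Hf Vf]. apply (C1_components Omega hopen) in Hf as [H1 H2]. auto.
Qed.

(** With [n] and [t] fixed by the argument, the closed form is linear in [u], [v], their partial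
    derivatives and the slope. *)
Lemma deval_add (Omega : C -> Prop) (hopen : open Omega) (f g : C -> C) (eta : dquat) :
  dquat_domain Omega eta -> C1_valid Omega f -> C1_valid Omega g ->
  deval (fun z => (f z + g z)%C) eta = (deval f eta + deval g eta)%dquat.
Proof.
  destruct eta as [A B]. intros Hz Hf Hg. change (A, B) with (mkdquat A B).
  change (Omega (zpt A)) in Hz.
  destruct (C1_valid_add Omega hopen f g Hf Hg) as [_ Vfg].
  apply (C1_valid_spec Omega hopen) in Hf as [Hf1 [Hf2 Vf]], Hg as [Hg1 [Hg2 Vg]].
  rewrite !(deval_explicit Omega) by assumption.
  unfold deval_std, deval_eps. cbv zeta.
  destruct (Hf1 _ Hz) as [df1 _], (Hf2 _ Hz) as [df2 _],
    (Hg1 _ Hz) as [dg1 _], (Hg2 _ Hz) as [dg2 _].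
  pose proof (par_x_plus _ _ _ df1 dg1) as E1. pose proof (par_x_plus _ _ _ df2 dg2) as E2.
  pose proof (par_y_plus _ _ _ df1 dg1) as E3. pose proof (par_y_plus _ _ _ df2 dg2) as E4.
  pose proof (slope_plus _ _ _ df2 dg2) as E5.
  cbv beta in E1, E2, E3, E4, E5.
  (* The two sides are convertible but not syntactically equal, and the rewriting needs the complex
     sum. *)
  change (fun w => Re (f w) + Re (g w)) with (fun w => Re (f w + g w)%C) in E1, E3.
  change (fun w => Im (f w) + Im (g w)) with (fun w => Im (f w + g w)%C) in E2, E4, E5.
  rewrite E1, E2, E3, E4, E5.
  change (Re (f (zpt A) + g (zpt A))%C) with (Re (f (zpt A)) + Re (g (zpt A))).
  change (Im (f (zpt A) + g (zpt A))%C) with (Im (f (zpt A)) + Im (g (zpt A))).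
  qsimpl. dquat_eq; ring.
Qed.

(** Conjugation negates [v], its partial derivatives and its slope; these are exactly the
    coefficients of the pure quaternions [n] and [b]. *)
Lemma deval_conj (Omega : C -> Prop) (hopen : open Omega) (f : C -> C) (eta : dquat) :
  dquat_domain Omega eta -> C1_valid Omega f ->
  deval (fun z => Cconj (f z)) eta = dconj (deval f eta).
Proof.
  destruct eta as [A B]. intros Hz Hf. change (A, B) with (mkdquat A B).
  change (Omega (zpt A)) in Hz.
  destruct (C1_valid_conj Omega hopen f Hf) as [_ Vc]. destruct Hf as [_ Vf].
  rewrite !(deval_explicit Omega) by assumption.
  unfold deval_std, deval_eps. cbv zeta.
  pose proof (par_x_opp (fun w => Im (f w)) (zpt A)) as E1.
  pose proof (par_y_opp (fun w => Im (f w)) (zpt A)) as E2.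
  pose proof (slope_opp (fun w => Im (f w)) (zpt A)) as E3.
  cbv beta in E1, E2, E3.
  change (fun w => - Im (f w)) with (fun w => Im (Cconj (f w))) in E1, E2, E3.
  rewrite E1, E2, E3.
  change (fun z => Re (Cconj (f z))) with (fun z => Re (f z)).
  change (Re (Cconj (f (zpt A)))) with (Re (f (zpt A))).
  change (Im (Cconj (f (zpt A)))) with (- Im (f (zpt A))).
  generalize (dir_pure A). generalize (dir A). intros n. qsimpl. intros ->.
  dquat_eq; ring.
Qed.

(* [ring] does not see through [R_UniformSpace] in the type of an equality. *)
Ltac Rring := match goal with |- @eq _ ?a ?b => change (@eq R a b) end; ring.

(** Only the outermost product of each summand is split: a factor containing a coordinate of [dir]
    may be continuous only as a whole. *)
Ltac cont_poly :=
  repeat match goal with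
  | |- continuous (fun x => @?f x + @?g x) _ => apply (continuous_Rplus f g)
  end;
  match goal with
  | |- continuous (fun x => @?f x * @?g x) _ => apply (continuous_Rmult f g)
  end.

(** * Multiplicativity *)

Lemma par_x_Re_mul (f g : C -> C) (z : C) :
  differentiable_at (fun w => Re (f w)) z -> differentiable_at (fun w => Im (f w)) z ->
  differentiable_at (fun w => Re (g w)) z -> differentiable_at (fun w => Im (g w)) z ->
  par_x (fun w => Re (f w * g w)%C) z =
    par_x (fun w => Re (f w)) z * Re (g z) + Re (f z) * par_x (fun w => Re (g w)) z
    - (par_x (fun w => Im (f w)) z * Im (g z) + Im (f z) * par_x (fun w => Im (g w)) z).
Proof.
  intros df1 df2 dg1 dg2.
  rewrite <- (par_x_mult _ _ _ df1 dg1), <- (par_x_mult _ _ _ df2 dg2).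
  unfold Rminus. rewrite <- par_x_opp.
  exact (par_x_plus _ _ _ (differentiable_mult _ _ _ df1 dg1)
           (differentiable_opp _ _ (differentiable_mult _ _ _ df2 dg2))).
Qed.

Lemma par_y_Re_mul (f g : C -> C) (z : C) :
  differentiable_at (fun w => Re (f w)) z -> differentiable_at (fun w => Im (f w)) z ->
  differentiable_at (fun w => Re (g w)) z -> differentiable_at (fun w => Im (g w)) z ->
  par_y (fun w => Re (f w * g w)%C) z =
    par_y (fun w => Re (f w)) z * Re (g z) + Re (f z) * par_y (fun w => Re (g w)) z
    - (par_y (fun w => Im (f w)) z * Im (g z) + Im (f z) * par_y (fun w => Im (g w)) z).
Proof.
  intros df1 df2 dg1 dg2.
  rewrite <- (par_y_mult _ _ _ df1 dg1), <- (par_y_mult _ _ _ df2 dg2).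
  unfold Rminus. rewrite <- par_y_opp.
  exact (par_y_plus _ _ _ (differentiable_mult _ _ _ df1 dg1)
           (differentiable_opp _ _ (differentiable_mult _ _ _ df2 dg2))).
Qed.

Lemma par_x_Im_mul (f g : C -> C) (z : C) :
  differentiable_at (fun w => Re (f w)) z -> differentiable_at (fun w => Im (f w)) z ->
  differentiable_at (fun w => Re (g w)) z -> differentiable_at (fun w => Im (g w)) z ->
  par_x (fun w => Im (f w * g w)%C) z =
    par_x (fun w => Re (f w)) z * Im (g z) + Re (f z) * par_x (fun w => Im (g w)) z
    + (par_x (fun w => Im (f w)) z * Re (g z) + Im (f z) * par_x (fun w => Re (g w)) z).
Proof.
  intros df1 df2 dg1 dg2.
  rewrite <- (par_x_mult _ _ _ df1 dg2), <- (par_x_mult _ _ _ df2 dg1).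
  exact (par_x_plus _ _ _ (differentiable_mult _ _ _ df1 dg2)
           (differentiable_mult _ _ _ df2 dg1)).
Qed.

Lemma par_y_Im_mul (f g : C -> C) (z : C) :
  differentiable_at (fun w => Re (f w)) z -> differentiable_at (fun w => Im (f w)) z ->
  differentiable_at (fun w => Re (g w)) z -> differentiable_at (fun w => Im (g w)) z ->
  par_y (fun w => Im (f w * g w)%C) z =
    par_y (fun w => Re (f w)) z * Im (g z) + Re (f z) * par_y (fun w => Im (g w)) z
    + (par_y (fun w => Im (f w)) z * Re (g z) + Im (f z) * par_y (fun w => Re (g w)) z).
Proof.
  intros df1 df2 dg1 dg2.
  rewrite <- (par_y_mult _ _ _ df1 dg2), <- (par_y_mult _ _ _ df2 dg1).
  exact (par_y_plus _ _ _ (differentiable_mult _ _ _ df1 dg2)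
           (differentiable_mult _ _ _ df2 dg1)).
Qed.

(* Off the real axis, [n = dir A] squares to -1 and anticommutes with the component
   of [qvec B] orthogonal to it, so the terms [slope * slope] cancel; on the real axis
   imaginary parts vanish and everything is central. *)
Lemma deval_mul (Omega : C -> Prop) (hopen : open Omega) (f g : C -> C) (eta : dquat) :
  dquat_domain Omega eta -> C1_valid Omega f -> C1_valid Omega g ->
  deval (fun z => (f z * g z)%C) eta = (deval f eta * deval g eta)%dquat.
Proof.
  destruct eta as [A B]. intros Hz Hf Hg. change (A, B) with (mkdquat A B).
  change (Omega (zpt A)) in Hz.
  destruct (C1_valid_mul Omega hopen f g Hf Hg) as [_ Vfg].
  apply (C1_valid_spec Omega hopen) in Hf as [Hf1 [Hf2 Vf]], Hg as [Hg1 [Hg2 Vg]].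
  rewrite !(deval_explicit Omega) by assumption.
  unfold deval_std, deval_eps. cbv zeta.
  destruct (Hf1 _ Hz) as [df1 _], (Hf2 _ Hz) as [df2 _],
    (Hg1 _ Hz) as [dg1 _], (Hg2 _ Hz) as [dg2 _].
  unfold slope. change (Im (zpt A)) with (qnorm (qvec A)).
  rewrite par_x_Re_mul, par_y_Re_mul, par_x_Im_mul, par_y_Im_mul by assumption.
  change (Re (f (zpt A) * g (zpt A))%C)
    with (Re (f (zpt A)) * Re (g (zpt A)) - Im (f (zpt A)) * Im (g (zpt A))).
  change (Im (f (zpt A) * g (zpt A))%C)
    with (Re (f (zpt A)) * Im (g (zpt A)) + Im (f (zpt A)) * Re (g (zpt A))).
  generalize (par_x (fun z => Re (f z)) (zpt A)) (par_y (fun z => Re (f z)) (zpt A))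
    (par_x (fun z => Im (f z)) (zpt A)) (par_y (fun z => Im (f z)) (zpt A))
    (par_x (fun z => Re (g z)) (zpt A)) (par_y (fun z => Re (g z)) (zpt A))
    (par_x (fun z => Im (g z)) (zpt A)) (par_y (fun z => Im (g z)) (zpt A)).
  intros ux uy vx vy px py qx' qy'.
  destruct (Req_EM_T (qnorm (qvec A)) 0) as [H|H].
  - rewrite (dir_0 A H).
    unfold zpt in *. rewrite H in *.
    rewrite (valid_real Omega f _ Vf Hz), (valid_real Omega g _ Vg Hz).
    destruct B as [[[? ?] ?] ?]. qsimpl. dquat_eq; ring.
  (* The inverse of [r] becomes a free variable [k]: the identity is polynomial in [k] and uses only
     that [n] is pure with [n . n = 1]. *)
  - unfold Rdiv. generalize (/ qnorm (qvec A)). intros k.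
    pose proof (dir_pure A) as Hw. pose proof (dir_dot A H) as Hn.
    destruct (dir A) as [[[n0 n1] n2] n3]. revert Hw Hn. qsimpl. intros -> Hn.
    assert (Hn' : n3 * n3 = 1 - n1 * n1 - n2 * n2) by lra.
    destruct B as [[[b0 b1] b2] b3].
    dquat_eq; ring [Hn'].
Qed.

(** * Continuity of the evaluation *)

Lemma continuous_qw (A : quat) : continuous qw A.
Proof.
  apply (continuous_comp (fun A : quat => fst (fst A)) fst);
    [|destruct A as [[[? ?] ?] ?]; apply continuous_fst].
  apply (continuous_comp (fun A : quat => fst A) fst);
    destruct A as [[[? ?] ?] ?]; apply continuous_fst.
Qed.

Lemma continuous_qx (A : quat) : continuous qx A.
Proof.
  apply (continuous_comp (fun A : quat => fst (fst A)) snd);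
    [|destruct A as [[[? ?] ?] ?]; apply continuous_snd].
  apply (continuous_comp (fun A : quat => fst A) fst);
    destruct A as [[[? ?] ?] ?]; apply continuous_fst.
Qed.

Lemma continuous_qy (A : quat) : continuous qy A.
Proof.
  apply (continuous_comp (fun A : quat => fst A) snd); destruct A as [[[? ?] ?] ?];
    [apply continuous_fst | apply continuous_snd].
Qed.

Lemma continuous_qz (A : quat) : continuous qz A.
Proof. destruct A as [[[? ?] ?] ?]. apply continuous_snd. Qed.

Lemma continuous_quat {U : UniformSpace} (F : U -> quat) (p : U) :
  continuous (fun t => qw (F t)) p -> continuous (fun t => qx (F t)) p ->
  continuous (fun t => qy (F t)) p -> continuous (fun t => qz (F t)) p ->
  continuous F p.
Proof.
  intros Hw Hx Hy Hz.
  apply continuous_ext with (fun t => (qw (F t), qx (F t), qy (F t), qz (F t))).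
  { intros t. now destruct (F t) as [[[? ?] ?] ?]. }
  apply (continuous_pair (W := R_UniformSpace)
           (fun t => (qw (F t), qx (F t), qy (F t))) (fun t => qz (F t))); [|exact Hz].
  apply (continuous_pair (W := R_UniformSpace)
           (fun t => (qw (F t), qx (F t))) (fun t => qy (F t))); [|exact Hy].
  exact (continuous_pair (V := R_UniformSpace) (W := R_UniformSpace)
           (fun t => qw (F t)) (fun t => qx (F t)) p Hw Hx).
Qed.

Lemma continuous_qnorm_qvec (A : quat) : continuous (fun A : quat => qnorm (qvec A)) A.
Proof.
  apply continuous_ext with
    (fun A : quat => sqrt (qx A * qx A + qy A * qy A + qz A * qz A)).
  - intros X. unfold qnorm. f_equal. qsimpl. ring.
  - apply (continuous_comp (fun A : quat => qx A * qx A + qy A * qy A + qz A * qz A) sqrt).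
    + cont_poly;
        first [apply continuous_qx | apply continuous_qy | apply continuous_qz].
    + apply continuous_sqrt.
Qed.

Lemma continuous_zpt (A : quat) : continuous zpt A.
Proof.
  exact (continuous_pair (V := R_UniformSpace) (W := R_UniformSpace) qw
           (fun A => qnorm (qvec A)) A (continuous_qw A) (continuous_qnorm_qvec A)).
Qed.

(** At [r = 0] this is a squeeze: the product is at most [Rabs phi] in absolute value, which tends
    to 0 even if [n] jumps. *)
Lemma continuous_off_real_mul (phi : C -> R) (n : quat -> R) (A : quat) :
  continuous phi (zpt A) -> (qnorm (qvec A) = 0 -> phi (zpt A) = 0) ->
  (forall X, Rabs (n X) <= 1) -> (qnorm (qvec A) <> 0 -> continuous n A) ->
  continuous (fun X => phi (zpt X) * n X) A.
Proof.
  intros Hphi H0 Hb Hn.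
  pose proof (continuous_comp zpt phi A (continuous_zpt A) Hphi) as Hc.
  destruct (Req_dec (qnorm (qvec A)) 0) as [H|H].
  - apply filterlim_locally. intros e.
    generalize (proj1 (filterlim_locally _ _) Hc e). apply filter_imp. intros X.
    rewrite (H0 H), Rmult_0_l.
    change (Rabs (phi (zpt X) - 0) < e -> Rabs (phi (zpt X) * n X - 0) < e).
    rewrite !Rminus_0_r, Rabs_mult. specialize (Hb X). intros HX.
    pose proof (Rabs_pos (phi (zpt X))). nra.
  - apply continuous_Rmult; [exact Hc | now apply Hn].
Qed.

Lemma continuous_dir (A : quat) : qnorm (qvec A) <> 0 ->
  continuous (fun X => qx (dir X)) A /\ continuous (fun X => qy (dir X)) A /\
  continuous (fun X => qz (dir X)) A.
Proof.
  intros H.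
  assert (Hc : continuous (fun X : quat => / qnorm (qvec X)) A).
  { apply (continuous_comp (fun X : quat => qnorm (qvec X)) Rinv).
    - apply continuous_qnorm_qvec.
    - now apply continuous_Rinv. }
  split; [|split].
  - apply continuous_ext with (fun X => / qnorm (qvec X) * qx X).
    + intros X. unfold dir. qsimpl. Rring.
    + apply continuous_Rmult; [exact Hc | apply continuous_qx].
  - apply continuous_ext with (fun X => / qnorm (qvec X) * qy X).
    + intros X. unfold dir. qsimpl. Rring.
    + apply continuous_Rmult; [exact Hc | apply continuous_qy].
  - apply continuous_ext with (fun X => / qnorm (qvec X) * qz X).
    + intros X. unfold dir. qsimpl. Rring.
    + apply continuous_Rmult; [exact Hc | apply continuous_qz].
Qed.

(** Each squared coordinate is at most [n . n], which is 1 or 0. *)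
Lemma dir_bounded (A : quat) :
  Rabs (qx (dir A)) <= 1 /\ Rabs (qy (dir A)) <= 1 /\ Rabs (qz (dir A)) <= 1.
Proof.
  assert (H : dot (dir A) (dir A) <= 1).
  { destruct (Req_dec (qnorm (qvec A)) 0) as [H|H].
    - rewrite (dir_0 A H). qsimpl. lra.
    - rewrite (dir_dot A H). lra. }
  revert H. unfold dot. generalize (qx (dir A)) (qy (dir A)) (qz (dir A)).
  intros x y z H. repeat split; apply Rabs_le; nra.
Qed.

Definition is_dir_component (n : quat -> R) : Prop :=
  n = (fun X => qx (dir X)) \/ n = (fun X => qy (dir X)) \/ n = (fun X => qz (dir X)).

Lemma Rabs_mult_le1 (x y : R) : Rabs x <= 1 -> Rabs y <= 1 -> Rabs (x * y) <= 1.
Proof.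
  intros Hx Hy. rewrite Rabs_mult. pose proof (Rabs_pos x). pose proof (Rabs_pos y). nra.
Qed.

(** In the coordinates of the closed form every product of coordinates of [n] can be attached to a
    coefficient vanishing on the real axis, which makes each summand continuous. *)
Lemma deval_continuous (Omega : C -> Prop) (hopen : open Omega) (f : C -> C) :
  C1_valid Omega f -> continuous_on (dquat_domain Omega) (deval f).
Proof.
  intros Hf. apply (C1_valid_spec Omega hopen) in Hf as [Hu [Hv Vf]].
  (* The closed form agrees with [deval f] on the domain, and there it is continuous at each point
     of the full space. *)
  apply continuous_on_ext with
    (fun eta : dquat => mkdquat (deval_std f (fst eta)) (deval_eps f (fst eta) (snd eta))).
  { intros [A B] Hz. symmetry. exact (deval_explicit Omega f A B Vf Hz). }
  apply continuous_on_forall. intros [A B] Hz. change (Omega (zpt A)) in Hz.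
  set (u := fun z => Re (f z)) in *. set (v := fun z => Im (f z)) in *.
  destruct (Hu _ Hz) as [du [cux cuy]], (Hv _ Hz) as [dv [cvx cvy]].
  apply differentiable_continuous in du, dv.
  assert (H0 : forall x, Omega (x, 0) -> v (x, 0) = 0)
    by (intros x Hx; now apply (valid_real Omega)).
  assert (cs : continuous (slope v) (zpt A)) by now apply (slope_continuous Omega).
  assert (Hd : qnorm (qvec A) = 0 -> zpt A = (qw A, 0))
    by (intros H; unfold zpt; now rewrite H).
  assert (cst : forall phi : quat -> R, continuous phi A ->
    continuous (fun eta : dquat => phi (fst eta)) (A, B)).
  { intros phi Hphi. apply (continuous_comp (fun eta : dquat => fst eta) phi); [|exact Hphi].
    apply continuous_fst. }
  assert (cB : forall c : quat -> R, continuous c B ->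
    continuous (fun eta : dquat => c (snd eta)) (A, B)).
  { intros c Hc. apply (continuous_comp (fun eta : dquat => snd eta) c); [|exact Hc].
    apply continuous_snd. }
  assert (cz : forall phi : C -> R, continuous phi (zpt A) ->
    continuous (fun eta : dquat => phi (zpt (fst eta))) (A, B)).
  { intros phi Hphi. apply (cst (fun X => phi (zpt X))).
    apply (continuous_comp zpt phi); [apply continuous_zpt | exact Hphi]. }
  assert (cn : forall phi n, continuous phi (zpt A) ->
    (qnorm (qvec A) = 0 -> phi (zpt A) = 0) ->
    (forall X, Rabs (n X) <= 1) -> (qnorm (qvec A) <> 0 -> continuous n A) ->
    continuous (fun eta : dquat => phi (zpt (fst eta)) * n (fst eta)) (A, B)).
  { intros phi n H1 H2 H3 H4. apply (cst (fun X => phi (zpt X) * n X)).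
    now apply continuous_off_real_mul. }
  (* This is [v_y - h], zero on the real axis, where [h] is [v_y] by definition. *)
  set (s := fun z => par_y v z - slope v z).
  assert (css : continuous s (zpt A))
    by (apply continuous_Rplus; [exact cvy | now apply continuous_Ropp]).
  assert (v0 : qnorm (qvec A) = 0 -> v (zpt A) = 0)
    by (intros H; rewrite (Hd H) in *; now apply H0).
  assert (uy0 : qnorm (qvec A) = 0 -> par_y u (zpt A) = 0)
    by (intros H; rewrite (Hd H) in *; now apply (par_y_Re_real Omega)).
  assert (vx0 : qnorm (qvec A) = 0 -> par_x v (zpt A) = 0)
    by (intros H; rewrite (Hd H) in *; now apply (par_x_Im_real Omega)).
  assert (s0 : qnorm (qvec A) = 0 -> s (zpt A) = 0)
    by (intros H; rewrite (Hd H); unfold s; rewrite slope_real; ring).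
  assert (cd : forall n, is_dir_component n ->
    (forall X, Rabs (n X) <= 1) /\ (qnorm (qvec A) <> 0 -> continuous n A)).
  { intros n Hn. split.
    - intros X. destruct (dir_bounded X) as [? [? ?]].
      destruct Hn as [->|[->| ->]]; assumption.
    - intros H. destruct (continuous_dir A H) as [? [? ?]].
      destruct Hn as [->|[->| ->]]; assumption. }
  assert (c1 : forall phi n, continuous phi (zpt A) ->
    (qnorm (qvec A) = 0 -> phi (zpt A) = 0) ->
    is_dir_component n ->
    continuous (fun eta : dquat => phi (zpt (fst eta)) * n (fst eta)) (A, B)).
  { intros phi n H1 H2 Hn. destruct (cd n Hn). now apply cn. }
  (* Products of two coordinates of [n] come from the term [t n], as [t] already contains [n]. *)
  assert (c2 : forall phi n m, continuous phi (zpt A) ->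
    (qnorm (qvec A) = 0 -> phi (zpt A) = 0) ->
    is_dir_component n ->
    is_dir_component m ->
    continuous (fun eta : dquat => phi (zpt (fst eta)) * (n (fst eta) * m (fst eta)))
      (A, B)).
  { intros phi n m H1 H2 Hn Hm. destruct (cd n Hn), (cd m Hm).
    apply (cn phi (fun X => n X * m X)); trivial.
    - intros X. now apply Rabs_mult_le1.
    - intros HA. apply continuous_Rmult; auto. }
  assert (cS : continuous (fun eta : dquat => deval_std f (fst eta)) (A, B)).
  { assert (cSn : forall n, is_dir_component n ->
      continuous (fun eta : dquat => v (zpt (fst eta)) * n (fst eta)) (A, B))
      by (intros n Hn; now apply c1).
    apply continuous_quat;
      [ generalize (cz u du) | generalize (cSn _ (or_introl eq_refl))
      | generalize (cSn _ (or_intror (or_introl eq_refl)))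
      | generalize (cSn _ (or_intror (or_intror eq_refl))) ];
      apply continuous_ext; intros [X Y]; generalize (dir_pure X);
      unfold deval_std, u, v; cbn [fst snd]; generalize (dir X);
      intros [[[n0 n1] n2] n3]; qsimpl; intros ->; Rring. }
  apply (continuous_pair (fun eta : dquat => deval_std f (fst eta))
           (fun eta : dquat => deval_eps f (fst eta) (snd eta))); [exact cS|].
  (* A vector coordinate of the dual part, with [t] multiplied out so that each product of two
     coordinates of [n] stands next to [s]. *)
  assert (cE : forall (n b : quat -> R),
    is_dir_component n -> continuous b B ->
    continuous (fun eta : dquat => slope v (zpt (fst eta)) * b (snd eta)
      + (par_x v (zpt (fst eta)) * n (fst eta)) * qw (snd eta)
      + ((s (zpt (fst eta)) * (n (fst eta) * qx (dir (fst eta)))) * qx (snd eta)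
      + (s (zpt (fst eta)) * (n (fst eta) * qy (dir (fst eta)))) * qy (snd eta)
      + (s (zpt (fst eta)) * (n (fst eta) * qz (dir (fst eta)))) * qz (snd eta))) (A, B)).
  { intros n b Hn Hb. cont_poly.
    - now apply cz.
    - now apply cB.
    - now apply c1.
    - apply cB, continuous_qw.
    - apply (c2 s n (fun X => qx (dir X))); trivial. now left.
    - apply cB, continuous_qx.
    - apply (c2 s n (fun X => qy (dir X))); trivial. now right; left.
    - apply cB, continuous_qy.
    - apply (c2 s n (fun X => qz (dir X))); trivial. now right; right.
    - apply cB, continuous_qz. }
  (* The real coordinate, where the coefficient of [t] is [u_y], again zero on the real axis. *)
  assert (cE0 : continuous (fun eta : dquat => par_x u (zpt (fst eta)) * qw (snd eta)
      + ((par_y u (zpt (fst eta)) * qx (dir (fst eta))) * qx (snd eta)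
      + (par_y u (zpt (fst eta)) * qy (dir (fst eta))) * qy (snd eta)
      + (par_y u (zpt (fst eta)) * qz (dir (fst eta))) * qz (snd eta))) (A, B)).
  { cont_poly.
    - now apply cz.
    - apply cB, continuous_qw.
    - apply (c1 (par_y u) (fun X => qx (dir X))); trivial. now left.
    - apply cB, continuous_qx.
    - apply (c1 (par_y u) (fun X => qy (dir X))); trivial. now right; left.
    - apply cB, continuous_qy.
    - apply (c1 (par_y u) (fun X => qz (dir X))); trivial. now right; right.
    - apply cB, continuous_qz. }
  apply continuous_quat;
    [ generalize cE0
    | generalize (cE _ qx (or_introl eq_refl) (continuous_qx B))
    | generalize (cE _ qy (or_intror (or_introl eq_refl)) (continuous_qy B))
    | generalize (cE _ qz (or_intror (or_intror eq_refl)) (continuous_qz B)) ];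
    apply continuous_ext; intros [X Y]; generalize (dir_pure X);
    unfold deval_eps; fold u; fold v; unfold s; cbn zeta; cbn [fst snd];
    generalize (par_x u (zpt X)) (par_y u (zpt X)) (par_x v (zpt X)) (par_y v (zpt X))
      (slope v (zpt X)) (dir X);
    intros ux uy vx vy h [[[n0 n1] n2] n3]; destruct Y as [[[? ?] ?] ?];
    qsimpl; intros ->; Rring.
Qed.

Theorem theorem2 (Omega : C -> Prop) (hopen : open Omega)
    (hsym : forall z : C, Omega z <-> Omega (Cconj z)) :
  (forall f : C -> C, C1_valid Omega f ->
     forall (a0 : R) (a1 : quat) (b0 : R) (b1 b2 : quat),
       pure a1 -> pure b1 -> pure b2 ->
       parallel b1 a1 -> perpendicular b2 a1 ->
       Omega (a0, qnorm a1) ->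
       deval f (mkdquat (a0 + a1) (b0 + b1 + b2))
         = deval_formula f a0 a1 b0 b1 b2
       /\ deval_formula f a0 a1 b0 b1 b2 = deval_formula' f a0 a1 b0 b1 b2)
  /\ functional_calculus Omega (C1_valid Omega) (dquat_domain Omega) deval
  /\ (forall f : C -> C, C1_valid Omega f ->
        continuous_on (dquat_domain Omega) (deval f)).
Proof.
  split; [|split].
  - intros f [_ Vf] a0 a1 b0 b1 b2 Ha Hb1 Hb2 Hpar Hperp Hz. split.
    + now apply (deval_decomposition Omega).
    + now apply (deval_formula_agree Omega).
  - split.
    + now apply C1_valid_const.
    + now apply C1_valid_id.
    + now apply C1_valid_add.
    + now apply C1_valid_mul.
    + now apply C1_valid_conj.
    + intros a f. now apply C1_valid_mul, C1_valid_const.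
    + intros f g eta Hz [_ Vf] [_ Vg]. now apply (deval_ext Omega).
    + intros eta Hz. now apply (deval_const Omega 1).
    + now apply deval_id.
    + now apply deval_add.
    + now apply deval_mul.
    + now apply deval_conj.
    (* The scalar law is the product law for the constant function [a], whose value is the real
       number [a]. *)
    + intros a f eta Hz Hf.
      rewrite (deval_mul Omega hopen (fun _ => RtoC a) f eta Hz
                 (C1_valid_const Omega hopen a) Hf).
      now rewrite (deval_const Omega a eta Hz).
  - now apply deval_continuous.
Qed.
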